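(* There exist $2^{\aleph_0}$ path-minimal prime graphs whose ages are pairwise incomparable with respect to set inclusion and each well-quasi-ordered under embeddability.
   Context: Graphs are simple, undirected, loopless. A graph embeds in another if it is isomorphic to an induced subgraph. The age of a graph is the class of finite graphs embedding in it; it is well-quasi-ordered if it contains no infinite antichain. A path is a graph whose vertices can be injectively mapped into an interval of $\mathbb{Z}$ so that adjacency means images differing by $1$; its length is its number of vertices minus one. A graph $G$ is path-minimal if for every $n$ it has an induced subgraph which is a finite path of length at least $n$, and every induced subgraph of $G$ with this property embeds $G$. A module of $G=(V,E)$ is a set $A\subseteq V$ such that every $v\notin A$ is adjacent to all or to none of the vertices of $A$; $\emptyset$, singletons and $V$ are trivial modules. $G$ is prime if it has more than three vertices and all its modules are trivial. *)

(* Defs.v *)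
From mathcomp Require Import all_boot all_order all_algebra.
From mathcomp Require Import boolp classical_sets functions cardinality.

Set Implicit Arguments.
Unset Strict Implicit.
Unset Printing Implicit Defensive.

Local Open Scope classical_set_scope.
Local Open Scope card_scope.

Record graph := Graph {
  vertex : Type;
  adj : vertex -> vertex -> Prop;
  adj_sym : forall u v, adj u v -> adj v u;
  adj_irrefl : forall u, ~ adj u u
}.

(* The vertex type is a plain sig type rather than set_type A: the latter lives
   in the universe of set, which would preclude forming set graph below. *)
Definition induced (G : graph) (A : set (vertex G)) : graph :=
  @Graph {x : vertex G | A x} (fun u v => adj (sval u) (sval v))
    (fun u v => @adj_sym G (sval u) (sval v))
    (fun u => @adj_irrefl G (sval u)).

Definition isomorphic (G H : graph) : Prop :=
  exists f : vertex G -> vertex H,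
    bijective f /\ forall u v, adj u v <-> adj (f u) (f v).

Definition embeds (H G : graph) : Prop :=
  exists A : set (vertex G), isomorphic H (induced A).

Definition finite_graph (G : graph) : Prop := finite_set [set: vertex G].

Definition age (G : graph) : set graph :=
  [set H | finite_graph H /\ embeds H G].

Definition wqo (C : set graph) : Prop :=
  ~ exists F : nat -> graph,
      (forall n, C (F n)) /\ (forall i j, i <> j -> ~ embeds (F i) (F j)).

Definition int_interval (I : set int) : Prop :=
  forall a b c : int, I a -> I b -> (a <= c <= b)%R -> I c.

(* The vertices fill up an interval of the integers: allowing f to skip values
   would make disjoint unions of paths (e.g. edgeless graphs) into paths. *)
Definition is_path (P : graph) : Prop :=
  exists f : vertex P -> int,
    [/\ injective f, int_interval (range f) &
        forall u v, adj u v <-> `|f u - f v|%R = 1%R].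

Definition finite_path_of_length (P : graph) (l : nat) : Prop :=
  is_path P /\ [set: vertex P] #= `I_l.+1.

Definition has_long_paths (G : graph) : Prop :=
  forall n : nat, exists (A : set (vertex G)) (l : nat),
    (n <= l)%N /\ finite_path_of_length (induced A) l.

Definition path_minimal (G : graph) : Prop :=
  has_long_paths G /\
  forall A : set (vertex G), has_long_paths (induced A) -> embeds G (induced A).

Definition is_module (G : graph) (A : set (vertex G)) : Prop :=
  forall v, ~ A v ->
    (forall a, A a -> adj v a) \/ (forall a, A a -> ~ adj v a).

Definition trivial_module (G : graph) (A : set (vertex G)) : Prop :=
  [\/ A = set0, exists x, A = [set x] | A = setT].

Definition prime_graph (G : graph) : Prop :=
  `I_4 #<= [set: vertex G] /\
  forall A : set (vertex G), is_module A -> trivial_module A.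

(* Main.v *)
Require Import Defs.
From mathcomp Require Import all_boot.
From mathcomp Require Import order ssralg ssrnum ssrint.
From mathcomp Require Import boolp classical_sets functions cardinality.
From mathcomp Require Import zify.

Set Implicit Arguments.
Unset Strict Implicit.
Unset Printing Implicit Defensive.

Local Open Scope classical_set_scope.
Local Open Scope card_scope.

(** For a binary word [u], take disjoint paths labelled by longer and longer prefixes
    of [u], and join every two vertices labelled 1 that lie in different paths
    ("blocks"). A long induced path of this graph has a long run inside a single block:
    the vertices of a path that are labelled 1 and lie in different blocks are few. If
    [u] is uniformly recurrent, such runs contain long prefixes of [u], which gives
    path-minimality; moreover the factors of [u] are well-quasi-ordered by the factor
    relation. A finite subgraph is obtained from factors by joining them twice, without
    edges to form the trace of a block, then with edges between the labels 1; by
    Higman's lemma each joining preserves well-quasi-orders.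

    Conversely, two blocks determine their labels on a long run, up to reversal, so an
    inclusion between ages forces long common factors up to reversal. The words are the
    Toeplitz words [u n = x (logn 2 n.+1)]: every window of length [2 ^ K] has as many
    ones as the number with binary digits [x 0 ... x K.-1], up to one more, so that
    distinct suitable digit sequences [x] give words without long common factors. Since
    the digits [x 0 = 0] and [x 1 = 1] are fixed, every 1 in [u] has a 0 just before it,
    whence primality. *)

(** * Almost-full relations and Higman's lemma *)

Lemma dependent_choice (T : Type) (R : nat -> T -> T -> Prop) (x0 : T) :
  (forall n x, exists y, R n x y) ->
  exists2 g : nat -> T, g 0 = x0 & forall n, R n (g n) (g n.+1).
Proof.
move=> totalR.
have /choice[c cR] : forall nx : nat * T, exists y, R nx.1 nx.2 y by case.
exists (fix g n := if n is n'.+1 then c (n', g n') else x0) => // n.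
exact: (cR (n, _)).
Qed.

Lemma increasing_choice (P : nat -> nat -> Prop) :
  (forall n N, exists2 m, N <= m & P n m) ->
  exists2 g : nat -> nat, {homo g : i j / i < j} & forall n, P n (g n).
Proof.
move=> unboundedP; have [m0 _ Pm0] := unboundedP 0 0.
have [|g g0 gS] := @dependent_choice nat (fun n x y => x < y /\ P n.+1 y) m0.
  by move=> n x; have [y] := unboundedP n.+1 x.+1; exists y.
exists g => [|[|n]]; [|by rewrite g0|exact: (gS n).2].
by apply: homo_ltn => [? ? ?|n]; [exact: ltn_trans | exact: (gS n).1].
Qed.

Section AlmostFull.
Variables (T : Type) (R : T -> T -> Prop).

Definition almost_full : Prop :=
  forall f : nat -> T, exists i j, i < j /\ R (f i) (f j).

Definition bad_sequence (f : nat -> T) : Prop :=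
  forall i j, i < j -> ~ R (f i) (f j).

Lemma not_almost_full : ~ almost_full -> exists f, bad_sequence f.
Proof.
by move=> /existsNP[f noR]; exists f => i j ij Rij; apply: noR; exists i, j.
Qed.

Lemma almost_full_monotone_subsequence (f : nat -> T) :
  RelationClasses.Transitive R -> almost_full ->
  exists2 g : nat -> nat, {homo g : i j / i < j} &
    forall i j, i < j -> R (f (g i)) (f (g j)).
Proof.
move=> trR fullR.
pose terminal n := forall m, n < m -> ~ R (f n) (f m).
have [N noterminal] : exists N, forall n, N <= n -> ~ terminal n.
  apply: contrapT => unbounded.
  have [|g gmono gterm] := @increasing_choice (fun=> terminal).
    move=> _ N; apply: contrapT => noterm; apply: unbounded; exists N => n leNn tn.
    by apply: noterm; exists n.
  have [i [j [ltij Rij]]] := fullR (f \o g).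
  exact: gterm (gmono _ _ ltij) Rij.
pose next n m := n < m /\ R (f n) (f m).
have [|g g0 gS] := @dependent_choice nat (fun _ n m => N <= n -> next n m) N.
  move=> _ n; have [leNn|_] := leqP N n; last by exists 0.
  have /existsNP[m /not_implyP[ltnm /contrapT Rnm]] := noterminal n leNn.
  by exists m.
have leNg n : N <= g n.
  elim: n => [|n IH]; first by rewrite g0.
  exact: leq_trans IH (ltnW (gS n IH).1).
have gnext : {homo g : i j / i < j >-> next i j}.
  apply: homo_ltn => [m n p [ltnm Rnm] [ltmp Rmp]|n]; last exact: gS.
  by split; [exact: ltn_trans ltmp | exact: trR Rmp].
by exists g => i j /gnext[].
Qed.

Lemma bad_sequence_minimal_at (size : T -> nat) (f : nat -> T) n :
  bad_sequence f ->
  exists g, [/\ bad_sequence g, forall i, i < n -> g i = f i &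
    forall h, bad_sequence h -> (forall i, i < n -> h i = f i) ->
      size (g n) <= size (h n)].
Proof.
move=> badf.
pose P k := `[< exists g, [/\ bad_sequence g, forall i, i < n -> g i = f i &
                              size (g n) = k] >].
have exP : exists k, P k by exists (size (f n)); apply/asboolP; exists f.
case: (ex_minnP exP) => k /asboolP[g [badg gf <-]] kmin.
by exists g; split=> // h badh hf; apply/kmin/asboolP; exists h.
Qed.

Lemma minimal_bad_sequence (size : T -> nat) :
  ~ almost_full ->
  exists2 f, bad_sequence f &
    forall g n, bad_sequence g -> (forall i, i < n -> g i = f i) ->
      size (f n) <= size (g n).
Proof.
move=> /not_almost_full[f0 badf0].
pose refines n (f g : nat -> T) := bad_sequence f ->
  [/\ bad_sequence g, forall i, i < n -> g i = f i &
    forall h, bad_sequence h -> (forall i, i < n -> h i = f i) ->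
      size (g n) <= size (h n)].
have [|F F0 FS] := @dependent_choice _ refines f0.
  move=> n f; have [badf|] := pselect (bad_sequence f); last by exists f.
  by have [g gP] := bad_sequence_minimal_at size n badf; exists g.
have badF n : bad_sequence (F n).
  by elim: n => [|n IH]; [rewrite F0 | have [] := FS n IH].
have Fdiag m i : i < m -> F m i = F i.+1 i.
  elim: m => // m IH; rewrite ltnS leq_eqVlt => /orP[/eqP -> //|ltim].
  by have [_ Fm _] := FS m (badF m); rewrite Fm// IH.
exists (fun n => F n.+1 n) => [i j ltij|g n badg gF].
  by rewrite -(Fdiag j.+1 i) ?ltnS ?(ltnW ltij)//; apply: (badF j.+1).
have [_ _ ->//] := FS n (badF n).
by move=> i ltin; rewrite gF// (Fdiag n).
Qed.

Inductive seq_embeds : seq T -> seq T -> Prop :=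
| SeqEmbedsNil t : seq_embeds [::] t
| SeqEmbedsSkip s y t : seq_embeds s t -> seq_embeds s (y :: t)
| SeqEmbedsCons x s y t : R x y -> seq_embeds s t -> seq_embeds (x :: s) (y :: t).

End AlmostFull.

(* Nash-Williams: in a minimal bad sequence, replace the terms from some point on by
   the tails of a subsequence with increasing heads; the result is still bad. *)
Lemma higman (T : Type) (R : T -> T -> Prop) :
  RelationClasses.Transitive R -> almost_full R -> almost_full (seq_embeds R).
Proof.
move=> trR fullR; apply: contrapT => /(minimal_bad_sequence size)[f badf minf].
have /choice[ht fE] : forall n, exists xs : T * seq T, f n = xs.1 :: xs.2.
  move=> n; case fn: (f n) => [|x s]; last by exists (x, s).
  by case: (badf n n.+1) => //; rewrite fn; constructor.
have [g gmono gR] := almost_full_monotone_subsequence (fst \o ht) trR fullR.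
have leg0 i : g 0 <= g i by case: i => // i; apply/ltnW/gmono.
pose h n := if n < g 0 then f n else (ht (g (n - g 0))).2.
suff badh : bad_sequence (seq_embeds R) h.
  have hf i : i < g 0 -> h i = f i by rewrite /h => ->.
  by have := minf h (g 0) badh hf; rewrite /h ltnn subnn [in X in X <= _]fE /= ltnn.
move=> i j ltij; rewrite /h.
case: (ltnP i) => lti; case: (ltnP j) => ltj emb.
- exact: badf emb.
- apply: (badf i (g (j - g 0))); first exact: leq_trans lti (leg0 _).
  by rewrite (fE (g _)); constructor.
- by have := leq_trans ltij (ltnW ltj); rewrite ltnNge lti.
- have ltg : i - g 0 < j - g 0 by rewrite ltn_sub2r // (leq_ltn_trans lti).
  apply: (badf _ _ (gmono _ _ ltg)).
  by rewrite (fE (g (i - g 0))) (fE (g (j - g 0))); constructor=> //; apply: gR.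
Qed.

Lemma almost_full_eq (T : finType) : almost_full (@eq T).
Proof.
move=> f; apply: contrapT => nocollision.
suff /leq_card : injective (fun i : 'I_#|T|.+1 => f i) by rewrite card_ord ltnn.
move=> i j fij; apply/val_inj; case: (ltngtP i j) => // lt; case: nocollision.
  by exists i, j.
by exists j, i.
Qed.

Definition almost_full_on (T : Type) (C : set T) (R : T -> T -> Prop) : Prop :=
  almost_full (fun x y : {x | C x} => R (sval x) (sval y)).

(** * Factors of infinite words *)

Definition factor (u : nat -> bool) (a n : nat) : seq bool := [seq u i | i <- iota a n].

Lemma size_factor u a n : size (factor u a n) = n.
Proof. by rewrite size_map size_iota. Qed.

Lemma nth_factor u a n i : i < n -> nth false (factor u a n) i = u (a + i).
Proof. by move=> ltin; rewrite (nth_map 0) ?size_iota// nth_iota. Qed.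

Lemma factorD u a m n : factor u a (m + n) = factor u a m ++ factor u (a + m) n.
Proof. by rewrite /factor iotaD map_cat. Qed.

Lemma infix_factor u a n b m :
  a <= b -> b + m <= a + n -> infix (factor u b m) (factor u a n).
Proof.
move=> leab lebm.
have -> : n = (b - a) + (m + (a + n - (b + m))) by lia.
by rewrite 2!factorD subnKC//; exact: infix_infix.
Qed.

Lemma infix_factorP u s a n :
  infix s (factor u a n) -> exists2 t, t + size s <= n & s = factor u (a + t) (size s).
Proof.
move=> /infixP[s1 [s2 us]].
have sizes := congr1 size us; rewrite !size_cat size_factor in sizes.
exists (size s1); first by rewrite sizes; lia.
move/eqP: us; rewrite sizes 2!factorD eqseq_cat ?size_factor// => /andP[_].
by rewrite eqseq_cat ?size_factor// => /andP[/eqP].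
Qed.

Definition two_ones_in_windows (u : nat -> bool) (n : nat) : Prop :=
  forall s, exists i j, [/\ i < j, j < n, u (s + i) & u (s + j)].

Definition uniformly_recurrent (u : nat -> bool) : Prop :=
  forall n, exists N, forall c,
    exists2 t, c <= t <= c + N & factor u t n = factor u 0 n.

(* The first factor lies in a prefix of [u], hence in every long factor; and two of the
   infinitely many short factors are equal. *)
Lemma almost_full_factors u : uniformly_recurrent u ->
  almost_full (fun v w : nat * nat => infix (factor u v.1 v.2) (factor u w.1 w.2)).
Proof.
move=> recu f; pose n := (f 0).1 + (f 0).2; have [N recN] := recu n.
have [[j [lt0j lej]]|allshort] := pselect (exists j, 0 < j /\ N + n <= (f j).2).
  exists 0, j; split=> //; have [t t_int ut] := recN (f j).1.
  apply: (@infix_trans _ (factor u 0 n)); first exact: infix_factor.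
  by rewrite -ut; apply: infix_factor; lia.
have short j : size (factor u (f j.+1).1 (f j.+1).2) <= N + n.
  rewrite size_factor leqNgt; apply/negP => /ltnW lej.
  by apply: allshort; exists j.+1.
have [i [j [ltij eqij]]] := almost_full_eq
  (fun j => insub_bseq (N + n) (factor u (f j.+1).1 (f j.+1).2)).
exists i.+1, j.+1; split=> //.
by move: (congr1 val eqij); rewrite !insubdK ?unfold_in//= => ->; apply: infix_refl.
Qed.

(** * Toeplitz words *)

Definition toeplitz (x : nat -> bool) (n : nat) : bool := x (logn 2 n.+1).

Lemma toeplitz_even x n : toeplitz x n.*2 = x 0.
Proof. by rewrite /toeplitz lognE /= dvdn2 /= odd_double. Qed.

Lemma toeplitz_odd x n : toeplitz x n.*2.+1 = toeplitz (x \o S) n.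
Proof. by rewrite /toeplitz /= -doubleS -mul2n lognM // (pfactorK 1). Qed.

Lemma toeplitz_periodic x k a i :
  i.+1 < 2 ^ k -> toeplitz x (a * 2 ^ k + i) = toeplitz x i.
Proof.
elim: k x a i => [|k IH] x a i; first by rewrite expn0.
rewrite -(odd_double_half i) expnS => lti.
have -> : a * (2 * 2 ^ k) = (a * 2 ^ k).*2 by rewrite -mul2n mulnCA.
case: (odd i) lti => lti.
  by rewrite add1n addnS -doubleD !toeplitz_odd IH //; lia.
by rewrite !add0n -doubleD !toeplitz_even.
Qed.

Lemma toeplitz_uniformly_recurrent x : uniformly_recurrent (toeplitz x).
Proof.
move=> n; exists (2 ^ n) => c.
exists ((c %/ 2 ^ n).+1 * 2 ^ n).
  have := divn_eq c (2 ^ n); have := ltn_pmod c (expn_gt0 2 n : 0 < _).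
  by rewrite mulSn; lia.
apply: (@eq_from_nth _ false); rewrite !size_factor // => i ltin.
by rewrite !nth_factor // toeplitz_periodic //; apply: leq_ltn_trans (ltn_expl n _).
Qed.

Lemma toeplitz_isolated_ones (x : nat -> bool) n :
  ~~ x 0 -> toeplitz x n.+1 -> ~~ toeplitz x n.
Proof.
move=> /negbTE x0; rewrite -(odd_double_half n); case: (odd n).
  by rewrite add1n -doubleS toeplitz_even x0.
by rewrite !toeplitz_even x0.
Qed.

Lemma toeplitz_two_ones (x : nat -> bool) n :
  x 1 -> 8 <= n -> two_ones_in_windows (toeplitz x) n.
Proof.
move=> x1 le8n s; have one a : toeplitz x a.*2.*2.+1.
  by rewrite toeplitz_odd toeplitz_even.
pose a := (s + 2) %/ 4; have a_int : s <= a.*2.*2.+1 < s + 4 by rewrite /a; lia.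
exists (a.*2.*2.+1 - s), (a.+1.*2.*2.+1 - s).
by rewrite !subnKC ?one; [split=> //; lia | lia | lia].
Qed.

Lemma count_factorS u a n :
  count id (factor u a n.+1) = count id (factor u a n) + u (a + n).
Proof. by rewrite -addn1 factorD count_cat /= addn0. Qed.

Lemma count_factor_toeplitz_double x p n :
  count id (factor (toeplitz x) p n.*2) =
    n * x 0 + count id (factor (toeplitz (x \o S)) p./2 n).
Proof.
elim: n => // n IH; rewrite doubleS !count_factorS {}IH mulSn.
have [pE|pE] : p = p./2.*2 \/ p = p./2.*2.+1.
  by have := odd_double_half p; case: (odd p); [right|left]; lia.
- have -> : p + n.*2 = (p./2 + n).*2 by lia.
  have -> : p + n.*2.+1 = (p./2 + n).*2.+1 by lia.
  by rewrite toeplitz_even toeplitz_odd; lia.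
- have -> : p + n.*2 = (p./2 + n).*2.+1 by lia.
  have -> : p + n.*2.+1 = (p./2 + n).+1.*2 by lia.
  by rewrite toeplitz_even toeplitz_odd; lia.
Qed.

(* The integer with binary digits [x 0, ..., x K.-1], most significant first. *)
Fixpoint prefix_value (x : nat -> bool) (K : nat) : nat :=
  if K is K'.+1 then 2 ^ K' * x 0 + prefix_value (x \o S) K' else 0.

Lemma count_factor_toeplitz x p K :
  prefix_value x K <= count id (factor (toeplitz x) p (2 ^ K)) <= (prefix_value x K).+1.
Proof.
elim: K x p => [|K IH] x p /=; first by case: toeplitz.
by rewrite expnS mul2n count_factor_toeplitz_double; have := IH (x \o S) p./2; lia.
Qed.

Lemma prefix_value_gap (x y : nat -> bool) k :
  (forall i, i < k -> x i = y i) -> x k -> ~~ y k -> ~~ y k.+1 ->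
  prefix_value y (k + 3) + 2 <= prefix_value x (k + 3).
Proof.
elim: k x y => [|k IH] x y xy xk yk yk1.
  by rewrite /= xk (negbTE yk) (negbTE yk1); case: (y 2); lia.
have gap := IH (x \o S) (y \o S) (fun i h => xy i.+1 h) xk yk yk1.
by rewrite addSn /= xy // -addnA leq_add2l.
Qed.

Lemma count_factor_toeplitz_neq (x y : nat -> bool) k p q :
  (forall i, i < k -> x i = y i) -> x k <> y k -> ~~ x k.+1 -> ~~ y k.+1 ->
  count id (factor (toeplitz x) p (2 ^ (k + 3))) <>
    count id (factor (toeplitz y) q (2 ^ (k + 3))).
Proof.
move=> xy xyk xk1 yk1.
have := count_factor_toeplitz x p (k + 3).
have := count_factor_toeplitz y q (k + 3).
case xk: (x k); case yk: (y k); rewrite ?xk ?yk // in xyk.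
  by have := prefix_value_gap xy xk (negbT yk) yk1; lia.
have yx i (lti : i < k) : y i = x i by rewrite xy.
by have := prefix_value_gap yx yk (negbT xk) xk1; lia.
Qed.

(** * Embeddings and induced paths *)

Definition embedding_on (G H : graph) (A : set (vertex G)) (f : vertex G -> vertex H) :
    Prop :=
  forall u v, A u -> A v -> (f u = f v -> u = v) /\ (adj u v <-> adj (f u) (f v)).

Lemma embedding_on_subset (G H : graph) (A B : set (vertex G))
    (f : vertex G -> vertex H) :
  A `<=` B -> embedding_on B f -> embedding_on A f.
Proof. by move=> AB fB u v /AB Bu /AB Bv; apply: fB. Qed.

Lemma embedding_on_comp (G H K : graph) (A : set (vertex G)) (B : set (vertex H))
    (f : vertex G -> vertex H) (g : vertex H -> vertex K) :
  (forall u, A u -> B (f u)) -> embedding_on A f -> embedding_on B g ->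
  embedding_on A (g \o f).
Proof.
move=> fAB fA gB u v Au Av; have [finj fadj] := fA u v Au Av.
have [ginj gadj] := gB _ _ (fAB u Au) (fAB v Av).
by split=> [/ginj/finj//|]; apply: iff_trans fadj gadj.
Qed.

Lemma sval_inj (T : Type) (P : T -> Prop) : injective (@sval T P).
Proof. by move=> x y; case: x y => [x Px] [y Py]; apply: eq_exist. Qed.

Lemma embedding_on_sval (G : graph) (A : set (vertex G)) :
  @embedding_on (induced A) G setT sval.
Proof. by move=> u v _ _; split=> // /sval_inj. Qed.

Lemma embedsP (H G : graph) :
  embeds H G <-> exists f : vertex H -> vertex G, embedding_on setT f.
Proof.
split=> [[A [f [/bij_inj finj fadj]]]|[f femb]].
  by exists (sval \o f) => u v _ _; split=> // /sval_inj/finj.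
pose f_range (v : vertex H) : vertex (induced (range f)) :=
  exist _ (f v) (imageT f v).
exists (range f), f_range; split=> [|u v]; last exact: (femb u v I I).2.
have /choice[g gK] : forall y, exists v, f_range v = y.
  by move=> [y fy]; have [v _ fv] := fy; exists v; apply: sval_inj.
have f_rangeI : injective f_range by move=> u v /(congr1 sval)/(femb u v I I).1.
by exists g => // v; apply: f_rangeI; rewrite gK.
Qed.

Lemma embeds_of_ranges (G H K : graph) (e : vertex G -> vertex K)
    (e' : vertex H -> vertex K) (f : vertex K -> vertex K) :
  embedding_on setT e -> embedding_on setT e' -> embedding_on (range e) f ->
  (forall x, range e x -> range e' (f x)) -> embeds G H.
Proof.
move=> eemb e'emb femb frange; apply/embedsP.
have /choice[g gE] : forall v, exists w, e' w = f (e v).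
  by move=> v; have [w _ <-] := frange _ (imageT e v); exists w.
exists g => u v _ _.
have [einj eadj] := eemb u v I I; have [_ e'adj] := e'emb (g u) (g v) I I.
have [finj fadj] := femb _ _ (imageT e u) (imageT e v); rewrite !gE in e'adj.
split=> [guv|]; first by apply/einj/finj; rewrite -!gE guv.
exact: iff_trans eadj (iff_trans fadj (iff_sym e'adj)).
Qed.

Lemma age_subset_embedding_on (G H : graph) (A : set (vertex G)) :
  age G `<=` age H -> finite_set A -> A !=set0 ->
  exists f : vertex G -> vertex H, embedding_on A f.
Proof.
move=> sub_age finA [x0 Ax0].
have fin_induced : finite_graph (induced A).
  have svalI : {in [set: vertex (induced A)] &, injective sval}.
    by move=> u v _ _; apply: sval_inj.
  rewrite /finite_graph -(eq_finite_set (inj_card_eq svalI)).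
  by apply: sub_finite_set finA => _ [u _ <-]; apply: svalP.
have [_ /embedsP[e eemb]] : age H (induced A).
  apply: sub_age; split=> //; apply/embedsP.
  by exists sval; apply: embedding_on_sval.
have /choice[f fE] : forall x, exists y, forall Ax : A x, y = e (exist _ x Ax).
  move=> x; have [Ax|nAx] := pselect (A x); last by exists (e (exist _ x0 Ax0)).
  by exists (e (exist _ x Ax)) => Ax'; rewrite (Prop_irrelevance Ax Ax').
exists f => u v Au Av; rewrite !fE.
have [einj eadj] := eemb (exist _ u Au) (exist _ v Av) I I.
by split=> // /einj/(congr1 sval).
Qed.

Definition consecutive (i j : nat) : bool := (i.+1 == j) || (j.+1 == i).

Lemma consecutiveC : symmetric consecutive.
Proof. by move=> i j; rewrite /consecutive orbC. Qed.

Lemma consecutive_irrefl : irreflexive consecutive.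
Proof. by move=> i; rewrite /consecutive; lia. Qed.

Lemma consecutiveD2l a i j : consecutive (a + i) (a + j) = consecutive i j.
Proof. by rewrite /consecutive -!addnS !eqn_add2l. Qed.

Lemma consecutive_square_free i i' j j' :
  consecutive i j -> consecutive i j' -> consecutive i' j -> consecutive i' j' ->
  i = i' \/ j = j'.
Proof. by rewrite /consecutive; lia. Qed.

Definition ray : graph :=
  @Graph nat consecutive (fun i j => etrans (consecutiveC j i))
    (fun i => elimF idP (consecutive_irrefl i)).

Definition induced_path (G : graph) (n : nat) (p : nat -> vertex G) : Prop :=
  @embedding_on ray G `I_n p.

Lemma induced_path_leq (G : graph) m n (p : nat -> vertex G) :
  m <= n -> induced_path n p -> induced_path m p.
Proof.
by move=> lemn; apply: embedding_on_subset => i /= ltim; apply: leq_trans lemn.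
Qed.

Lemma finite_set_minimum (I : set int) :
  finite_set I -> I !=set0 -> exists2 a, I a & forall b, I b -> (a <= b)%R.
Proof.
move=> /finite_seqP[s ->] [x0 /= sx0].
have s_gt0 : 0 < size s by case: s sx0.
pose k := [arg min_(k < Ordinal s_gt0) s`_k]%O%R.
exists (s`_k)%R => [|_ /(nthP 0%R)[i ltis <-]] /=; first exact: mem_nth.
by rewrite /k; case: Order.TotalTheory.arg_minP => // j _ /(_ (Ordinal ltis)); apply.
Qed.

Lemma int_interval_segment (I : set int) (l : nat) :
  int_interval I -> I #= `I_l.+1 -> exists a, forall i, i <= l -> I (a + i%:Z)%R.
Proof.
move=> intI cardI.
have finI : finite_set I by exists l.+1.
have I0 : I !=set0.
  have /card_set_bijP[f [_ _ fsurj]] := cardI.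
  by have [b Ib _] := fsurj 0 isT; exists b.
have [a Ia mina] := finite_set_minimum finI I0; exists a => i leil.
apply: contrapT => nIai.
have ltI b : I b -> (b < a + i%:Z)%R.
  move=> Ib; case: (Order.TotalTheory.ltP b (a + i%:Z)%R) => // leab.
  by case: nIai; apply: intI Ia Ib _; lia.
pose offset (b : int) := `|b - a|%N.
have offset_inj : {in I &, injective offset}.
  move=> b c /set_mem/mina leab /set_mem/mina leac; rewrite /offset; lia.
have : offset @` I `<=` `I_i.
  by move=> _ [b Ib <-] /=; have := ltI b Ib; have := mina b Ib; rewrite /offset; lia.
move=> /subset_card_le; rewrite (card_le_eql (inj_card_eq offset_inj)).
by rewrite (card_le_eql cardI) card_le_II; lia.
Qed.

Lemma finite_path_induced_path (P : graph) (l : nat) :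
  finite_path_of_length P l -> exists p : nat -> vertex P, induced_path l.+1 p.
Proof.
move=> [[f [finj intf fadj]] cardP].
have cardf : range f #= `I_l.+1.
  by rewrite (card_eql (inj_card_eq _))// => u v _ _; apply: finj.
have [a arange] := int_interval_segment intf cardf.
have [v0 _ _] := arange 0 (leq0n l).
have /choice[p pE] : forall i, exists v, i <= l -> f v = (a + i%:Z)%R.
  move=> i; have [/arange[v _ <-]|_] := leqP i l; last by exists v0.
  by exists v.
exists p => i j lti ltj; split=> [pij|].
  by have := pE i lti; rewrite pij pE //; lia.
by rewrite fadj !pE //= /consecutive; split; lia.
Qed.

Lemma induced_path_finite_path (G : graph) (l : nat) (p : nat -> vertex G) :
  induced_path l.+1 p -> finite_path_of_length (induced (p @` `I_l.+1)) l.
Proof.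
move=> ppath; set A := p @` `I_l.+1.
have /choice[f fP] : forall v : vertex (induced A),
    exists i : nat, i < l.+1 /\ p i = sval v.
  by move=> [v [i lti piv]]; exists i.
have finj : injective f.
  by move=> u v fuv; apply: sval_inj; rewrite -(fP u).2 -(fP v).2 fuv.
have fsurj i : i < l.+1 -> exists v, f v = i.
  move=> lti; have Api : A (p i) by exists i.
  exists (exist _ (p i) Api); have [ltf pf] := fP (exist _ (p i) Api).
  exact: (ppath _ _ ltf lti).1.
split; last first.
  apply/card_set_bijP; exists f; split=> [v _|u v _ _|i /fsurj[v <-]].
  - exact: (fP v).1.
  - exact: finj.
  - by exists v.
exists (fun v => Posz (f v)); split=> [u v [] /finj//|_ _ c [u _ <-] [v _ <-] lec|u v].
  have [|w fw] := fsurj `|c|%N; first by have := (fP v).1; lia.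
  by exists w => //; rewrite fw; lia.
have [ltu pu] := fP u; have [ltv pv] := fP v.
by rewrite /= -pu -pv -(ppath _ _ ltu ltv).2 /= /consecutive; split; lia.
Qed.

Lemma has_long_pathsP (G : graph) :
  has_long_paths G <-> forall n, exists p : nat -> vertex G, induced_path n p.
Proof.
split=> long n.
  have [A [l [lenl /finite_path_induced_path[p ppath]]]] := long n.
  exists (sval \o p); apply: (@induced_path_leq _ n l.+1); first exact: leqW.
  exact: embedding_on_comp ppath (@embedding_on_sval G A).
have [p ppath] := long n.+1.
by exists (p @` `I_n.+1), n; split=> //; apply: induced_path_finite_path.
Qed.

Definition sweeps_interval (q : nat -> nat) (n : nat) : Prop :=
  exists c, mkseq q n = iota c n \/ mkseq q n = rev (iota c n).

Lemma sweeps_interval_inj q n : sweeps_interval q n -> {in gtn n &, injective q}.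
Proof.
by move=> [c qE]; apply/mkseq_uniqP; case: qE => ->; rewrite ?rev_uniq iota_uniq.
Qed.

Lemma injective_walk_sweeps_interval (q : nat -> nat) (n : nat) :
  (forall i, i.+1 < n -> consecutive (q i) (q i.+1)) -> {in gtn n &, injective q} ->
  sweeps_interval q n.
Proof.
move=> step qinj.
have straight i : i.+2 < n -> q i.+2 + q i = (q i.+1).*2.
  move=> ltin; have : q i != q i.+2.
    by apply/eqP => /qinj; rewrite !inE /=; lia.
  by have := step i; have := step i.+1; rewrite /consecutive; lia.
have [le1|lt1] := leqP n 1.
  by exists (q 0); left; case: n le1 {step qinj straight} => [|[|]].
have [up|down] : q 1 = (q 0).+1 \/ q 0 = (q 1).+1.
  by have := step 0 lt1; rewrite /consecutive; lia.
- have incr i : i.+1 < n -> q i = q 0 + i /\ q i.+1 = q 0 + i.+1.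
    elim: i => [|i IH] ltin; first by lia.
    by have := straight i ltin; have := IH (ltnW ltin); lia.
  exists (q 0); left; apply: (@eq_from_nth _ 0); rewrite size_mkseq ?size_iota//.
  move=> [|i] ltin; rewrite nth_mkseq // nth_iota //; first by lia.
  by have := incr i ltin; lia.
- have decr i : i.+1 < n -> q 0 = q i + i /\ q 0 = q i.+1 + i.+1.
    elim: i => [|i IH] ltin; first by lia.
    by have := straight i ltin; have := IH (ltnW ltin); lia.
  have decrW i : i < n -> q 0 = q i + i by case: i => [|i /decr[]//]; rewrite addn0.
  exists (q n.-1); right.
  apply: (@eq_from_nth _ 0); rewrite size_mkseq ?size_rev ?size_iota// => i ltin.
  rewrite nth_mkseq // nth_rev ?size_iota // nth_iota; last by lia.
  by have := decrW i ltin; have := decrW n.-1; lia.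
Qed.

(** * The graph of a word *)

Definition block_adj (u : nat -> bool) (p q : nat * nat) : bool :=
  if p.1 == q.1 then consecutive p.2 q.2 else u p.2 && u q.2.

Lemma block_adjC u : symmetric (block_adj u).
Proof. by move=> p q; rewrite /block_adj eq_sym consecutiveC andbC. Qed.

Lemma block_adj_irrefl u : irreflexive (block_adj u).
Proof. by move=> p; rewrite /block_adj eqxx consecutive_irrefl. Qed.

Definition block_graph (u : nat -> bool) : graph :=
  @Graph (nat * nat) (block_adj u) (fun p q => etrans (block_adjC u q p))
    (fun p => elimF idP (block_adj_irrefl u p)).

(* The disjoint union of the paths labelled by the prefixes of [u] of length at
   least 6, with all edges added between vertices labelled 1 in distinct paths. *)
Definition word_graph (u : nat -> bool) : graph :=
  @induced (block_graph u) [set p | p.2 < p.1 + 6].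

Section InducedPathRun.
Variables (u : nat -> bool) (N : nat) (p : nat -> vertex (block_graph u)).
Hypothesis ppath : induced_path N p.

Lemma block_adj_induced_path i j :
  i < N -> j < N -> block_adj u (p i) (p j) = consecutive i j.
Proof. by move=> lti ltj; have [_ padj] := ppath lti ltj; apply/idP/idP => /padj. Qed.

(* The ends of an edge between two blocks are labelled 1, so they are adjacent to every
   vertex labelled 1 of another block. An end of a second such edge, far along the path,
   is adjacent to neither end of the first one, so it would lie in both blocks. *)
Lemma block_change_unique i j :
  (p i).1 <> (p i.+1).1 -> i + 3 <= j -> j.+1 < N -> (p j.+1).1 = (p j).1.
Proof.
move=> change_i leij ltjN; apply: contrapT => change_j; apply: (change_i).
have labels k l : k < N -> l < N -> (p k).1 <> (p l).1 ->
    u (p k).2 && u (p l).2 = consecutive k l.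
  by move=> ltk ltl /eqP/negbTE ne; rewrite -block_adj_induced_path // /block_adj ne.
have ui : u (p i).2 && u (p i.+1).2 by rewrite labels /consecutive; lia.
have uj : u (p j.+1).2 && u (p j).2 by rewrite labels /consecutive; lia.
transitivity (p j).1; last apply: esym.
  by apply: contrapT => /labels; rewrite /consecutive; lia.
by apply: contrapT => /labels; rewrite /consecutive; lia.
Qed.

End InducedPathRun.

Lemma induced_path_run u n (p : nat -> vertex (block_graph u)) :
  induced_path (2 * n + 4) p ->
  exists s b q, [/\ s + n <= 2 * n + 4, forall i, i < n -> p (s + i) = (b, q i) &
    sweeps_interval q n].
Proof.
move=> ppath.
have [s [les stay]] : exists s, s + n <= 2 * n + 4 /\
    forall i, i.+1 < n -> (p (s + i).+1).1 = (p (s + i)).1.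
  have [[i [lti change]]|nochange] :=
    pselect (exists i, i < n /\ (p i).1 <> (p i.+1).1).
    exists (n + 3); split=> [|j ltj]; first by lia.
    by apply: (block_change_unique ppath change); lia.
  exists 0; split=> [|i lti]; first by lia.
  by apply: contrapT => change; apply: nochange; exists i; split; [lia | apply: nesym].
have pE i : i < n -> p (s + i) = ((p s).1, (p (s + i)).2).
  move=> lti; suff <- : (p (s + i)).1 = (p s).1 by case: (p (s + i)).
  by elim: i lti => [|i IH] lti; rewrite ?addn0// addnS stay// IH// ltnW.
exists s, (p s).1, (fun i => (p (s + i)).2); split=> //.
apply: injective_walk_sweeps_interval => [i lti|i j].
  have := block_adj_induced_path ppath (i := s + i) (j := s + i.+1).
  rewrite /block_adj (pE i (ltnW lti)) (pE i.+1 lti) /= eqxx /consecutive; lia.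
rewrite !inE => /= lti ltj eqp; apply: (@addnI s).
have [||pinj _] := @ppath (s + i) (s + j); [rewrite /=; lia | rewrite /=; lia |].
by apply: pinj; rewrite pE // eqp -pE.
Qed.

Section BlockVertex.
Variable u : nat -> bool.

Lemma block_vertex_subproof b i : (b, minn i (b + 5)).2 < (b, minn i (b + 5)).1 + 6.
Proof. by rewrite /=; lia. Qed.

(* Meaningful only when [i < b + 6]; otherwise it is the last vertex of the block. *)
Definition block_vertex (b i : nat) : vertex (word_graph u) :=
  exist _ (b, minn i (b + 5)) (block_vertex_subproof b i).

Lemma sval_block_vertex b i : i < b + 6 -> sval (block_vertex b i) = (b, i).
Proof. by move=> lti /=; congr pair; lia. Qed.

Lemma block_vertex_sval (v : vertex (word_graph u)) :
  block_vertex (sval v).1 (sval v).2 = v.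
Proof.
by apply: sval_inj; rewrite sval_block_vertex -?surjective_pairing//; apply: (svalP v).
Qed.

Lemma adj_block_vertex b i b' i' : i < b + 6 -> i' < b' + 6 ->
  adj (block_vertex b i) (block_vertex b' i') = block_adj u (b, i) (b', i').
Proof. by move=> lti lti'; rewrite -!sval_block_vertex. Qed.

Lemma block_vertex_induced_path b n : n <= b + 6 -> induced_path n (block_vertex b).
Proof.
move=> len i j /leq_trans/(_ len) lti /leq_trans/(_ len) ltj.
split=> [/(congr1 sval)|]; first by rewrite !sval_block_vertex // => -[].
by rewrite adj_block_vertex // /block_adj eqxx.
Qed.

End BlockVertex.

(** * Path-minimality *)

Lemma word_graph_long_paths u : has_long_paths (word_graph u).
Proof.
apply/has_long_pathsP => n; exists (block_vertex u n).
exact/block_vertex_induced_path/leq_addr.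
Qed.

Definition contains_run u (A : set (vertex (word_graph u))) (b c n : nat) : Prop :=
  forall i, i < n -> exists2 v, A v & sval v = (b, c + i).

Lemma long_paths_run u (A : set (vertex (word_graph u))) n :
  has_long_paths (induced A) -> exists b c, n <= b /\ contains_run A b c (n + 6).
Proof.
move=> /has_long_pathsP/(_ (2 * (n + 6) + 4))[p ppath].
pose e (v : vertex (induced A)) : vertex (block_graph u) := sval (sval v).
have eemb : embedding_on setT e.
  exact: (embedding_on_comp _ (@embedding_on_sval _ A) (@embedding_on_sval _ _)).
have [|s [b [q [_ pE [c qE]]]]] := @induced_path_run u (n + 6) (e \o p).
  exact: embedding_on_comp eemb.
have run : contains_run A b c (n + 6).
  move=> i lti; have : c + i \in mkseq q (n + 6).
    by case: qE => ->; rewrite ?mem_rev mem_iota; lia.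
  case/mapP=> j; rewrite mem_iota /= => ltj ->; exists (sval (p (s + j))).
    exact: svalP.
  exact: pE.
exists b, c; split=> //; have [|v _ vE] := run (n + 5); first by lia.
by have := svalP v; rewrite vE /=; lia.
Qed.

Lemma long_paths_prefix u (A : set (vertex (word_graph u))) n N :
  uniformly_recurrent u -> has_long_paths (induced A) ->
  exists2 b, N <= b &
    exists2 t, factor u t n = factor u 0 n & contains_run A b t n.
Proof.
move=> recu longA; have [R recR] := recu n.
have [b [c [leb run]]] := long_paths_run (R + n + N) longA.
exists b; first by lia.
have [t t_int ut] := recR c; exists t => // i lti.
have [|v Av vE] := run (t - c + i); first by lia.
by exists v; rewrite // vE; congr pair; lia.
Qed.

Lemma word_graph_path_minimal u :
  uniformly_recurrent u -> path_minimal (word_graph u).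
Proof.
move=> recu; split=> [|A longA]; first exact: word_graph_long_paths.
have [|g gmono gP] := @increasing_choice (fun n b =>
    exists2 t, factor u t (n + 6) = factor u 0 (n + 6) & contains_run A b t (n + 6)).
  by move=> n N; apply: long_paths_prefix.
have ginj : injective g := incn_inj (leq_mono gmono).
have /choice[t tP] : forall n, exists t, forall i, i < n + 6 ->
    u (t + i) = u i /\ exists2 v, A v & sval v = (g n, t + i).
  move=> n; have [t ut run] := gP n; exists t => i lti; split; last exact: run.
  by rewrite -(nth_factor u t lti) ut nth_factor.
have /choice[f fE] : forall v : vertex (word_graph u), exists w : vertex (induced A),
    sval (sval w) = (g (sval v).1, t (sval v).1 + (sval v).2).
  by move=> [[n i] /= lti]; have [_ [w Aw wE]] := tP n i lti; exists (exist _ w Aw).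
apply/embedsP; exists f => v w _ _; split=> [fvw|].
  apply: sval_inj; have := fE v; rewrite fvw fE => -[/ginj].
  by case: (sval v) (sval w) => [n i] [m j] /= -> /addnI ->.
rewrite /= !fE /block_adj /= (inj_eq ginj).
rewrite (tP _ _ (svalP v)).1 (tP _ _ (svalP w)).1.
by case: eqVneq => [->|//]; rewrite consecutiveD2l.
Qed.

(** * Primality *)

Lemma module_mem (G : graph) (A : set (vertex G)) x y v :
  is_module A -> A x -> A y -> adj v x -> ~ adj v y -> A v.
Proof.
move=> modA Ax Ay vx vy; apply: contrapT => nAv.
by have [/(_ _ Ay)|/(_ _ Ax)] := modA v nAv.
Qed.

Section PathModule.
Variables (k : nat) (B : set nat).
Hypothesis k_gt3 : 3 < k.
Hypothesis modB : forall x y v, x < k -> y < k -> v < k -> B x -> B y ->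
  consecutive v x -> ~~ consecutive v y -> B v.

Lemma path_module_full_of_edge i : i.+1 < k -> B i -> B i.+1 -> forall v, v < k -> B v.
Proof.
move=> ltik Bi Bi1.
have up d : i + d.+1 < k -> B (i + d) /\ B (i + d.+1).
  elim: d => [|d IH] ltdk; first by rewrite addn0 addn1.
  have [|Bd Bd1] := IH; first by lia.
  by split=> //; apply: (modB (x := i + d.+1) (y := i + d)) => //;
    rewrite /consecutive; lia.
have down d : d <= i -> B (i - d) /\ B (i - d).+1.
  elim: d => [|d IH] ltdi; first by rewrite subn0.
  have [|Bd Bd1] := IH; first by lia.
  rewrite subnSK //; split=> //.
  by apply: (modB (x := i - d) (y := (i - d).+1)) => //; rewrite /consecutive; lia.
move=> v ltv; have [levi|ltiv] := leqP v i.
  by have [|Bv _] := down (i - v); [lia | rewrite subKn in Bv].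
have -> : v = i + (v - i.+1).+1 by lia.
by apply: (up _ _).2; lia.
Qed.

Lemma path_module_full i j : i < j -> j < k -> B i -> B j -> forall v, v < k -> B v.
Proof.
move=> ltij ltjk Bi Bj.
have [eqj|nej1] := eqVneq j i.+1.
  by subst j; exact: path_module_full_of_edge ltjk Bi Bj.
have [eqj|nej2] := eqVneq j i.+2.
  subst j; case: i => [|i] in ltij ltjk Bi Bj nej1 *.
    apply: (@path_module_full_of_edge 2) => //.
    by apply: (modB (x := 2) (y := 0)) => //; lia.
  apply: (@path_module_full_of_edge i) => //; first by lia.
  by apply: (modB (x := i.+1) (y := i.+3)) => //; rewrite /consecutive; lia.
apply: (@path_module_full_of_edge i) => //; first by lia.
by apply: (modB (x := i) (y := j)) => //; rewrite /consecutive; lia.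
Qed.

End PathModule.

Section WordGraphModule.
Variables (u : nat -> bool) (A : set (vertex (word_graph u))).
Hypothesis modA : is_module A.

Lemma module_block_vertex b i b' i' c k :
  i < b + 6 -> i' < b' + 6 -> k < c + 6 ->
  A (block_vertex u b i) -> A (block_vertex u b' i') ->
  block_adj u (c, k) (b, i) -> ~~ block_adj u (c, k) (b', i') ->
  A (block_vertex u c k).
Proof.
move=> lti lti' ltk Ai Ai' ki /negP ki'.
by apply: (module_mem modA Ai Ai'); rewrite adj_block_vertex.
Qed.

Lemma module_full_block b i j :
  i < j -> j < b + 6 -> A (block_vertex u b i) -> A (block_vertex u b j) ->
  forall k, k < b + 6 -> A (block_vertex u b k).
Proof.
move=> ltij ltj Ai Aj.
apply: (@path_module_full (b + 6) [set k | A (block_vertex u b k)] _ _ i j) => //.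
  by rewrite addnC.
move=> x y v ltx lty ltv Ax Ay vx vy.
by apply: (module_block_vertex ltx lty ltv Ax Ay); rewrite /block_adj eqxx.
Qed.

(* A vertex labelled 1 in another block distinguishes the vertices labelled 0 and 1 of
   a full block. *)
Lemma module_full b (i j : nat) :
  ~~ u 0 -> i < j < 6 -> u i -> u j ->
  (forall k, k < b + 6 -> A (block_vertex u b k)) -> A = setT.
Proof.
move=> u0 /andP[ltij ltj6] ui uj Ab; apply/seteqP; split=> // v _.
rewrite -(block_vertex_sval v); set m := (sval v).1.
have ltv : (sval v).2 < m + 6 by apply: (svalP v).
have [mb|nemb] := eqVneq m b; first by rewrite mb in ltv *; apply: Ab.
have Aone l : l < 6 -> u l -> A (block_vertex u m l).
  move=> ltl ul.
  have [ltib lt0b ltlm] : [/\ i < b + 6, 0 < b + 6 & l < m + 6] by split; lia.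
  apply: (module_block_vertex ltib lt0b ltlm (Ab i ltib) (Ab 0 lt0b)).
    by rewrite /block_adj /= ifN // ul.
  by rewrite /block_adj /= ifN // (negbTE u0) andbF.
have lti6 := ltn_trans ltij ltj6.
by apply: (module_full_block ltij _ (Aone i lti6 ui) (Aone j ltj6 uj) ltv); lia.
Qed.

(* If the second vertex is labelled 1, then the vertex before it, labelled 0, is
   adjacent to it but not to the first vertex. If it is labelled 0, then it is not
   adjacent to the neighbors of the first vertex in the block of the latter. *)
Lemma module_meets_block_twice b i b' i' :
  ~~ u 0 -> (forall n, u n.+1 -> ~~ u n) ->
  b <> b' -> i < b + 6 -> i' < b' + 6 ->
  A (block_vertex u b i) -> A (block_vertex u b' i') ->
  exists c k l, [/\ k < l, l < c + 6, A (block_vertex u c k) & A (block_vertex u c l)].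
Proof.
move=> u0 isolated /eqP/negbTE nebb' lti lti' Ai Ai'.
have [ui'|nui'] := boolP (u i').
  case: i' => [|k] in lti' Ai' ui' *; first by rewrite ui' in u0.
  exists b', k, k.+1; split=> //.
  apply: (module_block_vertex lti' lti _ Ai' Ai); first by lia.
    by rewrite /block_adj eqxx /consecutive eqxx.
  by rewrite /block_adj /= eq_sym nebb' (negbTE (isolated k ui')).
have Anear k : k < b + 6 -> consecutive k i -> A (block_vertex u b k).
  move=> ltk ki; apply: (module_block_vertex lti lti' ltk Ai Ai').
    by rewrite /block_adj eqxx.
  by rewrite /block_adj /= nebb' (negbTE nui') andbF.
case: i => [|i] in lti Ai Anear *.
  by exists b, 0, 1; split=> //; [lia | apply: Anear => //; lia].
by exists b, i, i.+1; split=> //; apply: Anear; rewrite /consecutive; lia.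
Qed.

End WordGraphModule.

Lemma word_graph_prime u (i j : nat) :
  ~~ u 0 -> (forall n, u n.+1 -> ~~ u n) -> i < j < 6 -> u i -> u j ->
  prime_graph (word_graph u).
Proof.
move=> u0 isolated ltij6 ui uj; split.
  have inj0 : {in `I_4 &, injective (block_vertex u ^~ 0)}.
    by move=> b b' _ _ /(congr1 sval)[].
  by rewrite -(card_le_eql (inj_card_eq inj0)); apply: subset_card_le.
move=> A modA.
have [[v Av]|noA] := pselect (A !=set0); last first.
  by constructor 1; apply/eqP; apply: contrapT => /negP/set0P.
have [[w [Aw ne]]|single] := pselect (exists w, A w /\ w <> v); last first.
  constructor 2; exists v; apply/seteqP; split=> [w Aw /=|w -> //].
  by apply: contrapT => ne; apply: single; exists w.
constructor 3.
suff [b [k [l [ltkl ltl Ak Al]]]] : exists b k l,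
    [/\ k < l, l < b + 6, A (block_vertex u b k) & A (block_vertex u b l)].
  exact: (module_full modA u0 ltij6 ui uj (module_full_block modA ltkl ltl Ak Al)).
have ltv : (sval v).2 < (sval v).1 + 6 by apply: (svalP v).
have ltw : (sval w).2 < (sval w).1 + 6 by apply: (svalP w).
have neq : sval w <> sval v by move/sval_inj.
rewrite -(block_vertex_sval v) in Av; rewrite -(block_vertex_sval w) in Aw.
have [eq1|/eqP ne1] := eqVneq (sval v).1 (sval w).1; last first.
  exact: (module_meets_block_twice modA u0 isolated ne1 ltv ltw Av Aw).
rewrite -eq1 in Aw ltw.
case: (ltngtP (sval v).2 (sval w).2) => [lt|lt|eq2].
- by exists (sval v).1, (sval v).2, (sval w).2.
- by exists (sval v).1, (sval w).2, (sval v).2.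
- by case: neq; rewrite [LHS]surjective_pairing [RHS]surjective_pairing eq1 eq2.
Qed.

(** * Well-quasi-ordered ages *)

Section LabelledEmbeddings.
Variables (G : graph) (L : Type) (label : vertex G -> L).

Definition label_embeds (A B : set (vertex G)) : Prop :=
  exists f : vertex G -> vertex G,
    [/\ forall x, A x -> B (f x), embedding_on A f &
        forall x, A x -> label (f x) = label x].

Lemma label_embeds_trans : RelationClasses.Transitive label_embeds.
Proof.
move=> A B C [f [fAB femb flabel]] [g [gBC gemb glabel]]; exists (g \o f); split.
- by move=> x /fAB/gBC.
- exact: embedding_on_comp femb gemb.
- by move=> x Ax /=; rewrite glabel ?flabel//; apply: fAB.
Qed.

Lemma label_embeds_subset A B C : label_embeds A B -> B `<=` C -> label_embeds A C.
Proof. by move=> [f [fAB femb flabel]] BC; exists f; split=> // x /fAB/BC. Qed.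

Definition joined (c : L -> L -> Prop) (A B : set (vertex G)) : Prop :=
  forall x y, A x -> B y -> x <> y /\ (adj x y <-> c (label x) (label y)).

Lemma label_embeds_setU c A A' B B' :
  joined c A A' -> joined c B B' -> label_embeds A B -> label_embeds A' B' ->
  label_embeds (A `|` A') (B `|` B').
Proof.
move=> joinA joinB [f [fAB femb flabel]] [g [gAB gemb glabel]].
pose h x := if `[< A x >] then f x else g x.
have hf x : A x -> h x = f x by rewrite /h; case: asboolP.
have hg x : A' x -> h x = g x.
  by rewrite /h; case: asboolP => // Ax A'x; case: (joinA x x Ax A'x).
have cross x y : A x -> A' y ->
    (h x = h y -> x = y) /\ (adj x y <-> adj (h x) (h y)).
  move=> Ax A'y; have [_ adjA] := joinA x y Ax A'y.
  have [ne adjB] := joinB _ _ (fAB x Ax) (gAB y A'y).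
  rewrite hf // hg //; split=> //.
  by rewrite flabel // glabel // in adjB; apply: iff_trans adjA (iff_sym adjB).
exists h; split=> [x [Ax|A'x]|x y [Ax|A'x] [Ay|A'y]|x [Ax|A'x]].
- by left; rewrite hf //; apply: fAB.
- by right; rewrite hg //; apply: gAB.
- by rewrite !hf //; apply: femb.
- exact: cross.
- by have [hinj hadj] := cross y x Ay A'x; split=> [/esym/hinj//|];
    split=> /adj_sym/hadj/adj_sym.
- by rewrite !hg //; apply: gemb.
- by rewrite hf // flabel.
- by rewrite hg // glabel.
Qed.

Inductive join_of (c : L -> L -> Prop) (I : Type) (S : I -> set (vertex G)) :
    seq I -> set (vertex G) -> Prop :=
| JoinNil : join_of c S [::] set0
| JoinCons i s A :
    joined c (S i) A -> join_of c S s A -> join_of c S (i :: s) (S i `|` A).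

Lemma label_embeds_join_of c (I : Type) (S : I -> set (vertex G)) s t A B :
  seq_embeds (fun i j => label_embeds (S i) (S j)) s t ->
  join_of c S s A -> join_of c S t B -> label_embeds A B.
Proof.
move=> st; elim: st A B => {s t} [t|s j t _ IH|i s j t ij _ IH] A B joinA joinB.
- by inversion joinA; exists id.
- inversion joinB as [|? ? B' ? joinB']; subst.
  by apply: label_embeds_subset (IH _ _ joinA joinB') _; apply: subsetUr.
- inversion joinA as [|? ? A' jA joinA']; inversion joinB as [|? ? B' jB joinB']; subst.
  exact: label_embeds_setU jA jB ij (IH _ _ joinA' joinB').
Qed.

Definition joins (c : L -> L -> Prop) (C : set (set (vertex G))) :
    set (set (vertex G)) :=
  [set A | exists s, join_of c (fun B : {B | C B} => sval B) s A].

Lemma joins_set0 c C : joins c C set0.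
Proof. by exists [::]; constructor. Qed.

Lemma joins_setU c (C : set (set (vertex G))) A B :
  C A -> joins c C B -> joined c A B -> joins c C (A `|` B).
Proof. by move=> CA [s joinB] jAB; exists (exist _ A CA :: s); constructor. Qed.

Lemma almost_full_on_joins c C :
  almost_full_on C label_embeds -> almost_full_on (joins c C) label_embeds.
Proof.
move=> fullC F; have /choice[s sP] := fun n => svalP (F n).
have trC : RelationClasses.Transitive
    (fun A B : {B | C B} => label_embeds (sval A) (sval B)).
  by move=> A B D; apply: label_embeds_trans.
have [i [j [ltij sij]]] := higman trC fullC s.
by exists i, j; split=> //; apply: label_embeds_join_of sij (sP i) (sP j).
Qed.

End LabelledEmbeddings.

Definition never_adjacent (s t : bool) : Prop := False.

Definition ones_adjacent (s t : bool) : Prop := s && t.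

Section BlockSets.
Variable u : nat -> bool.

Let V : Type := vertex (block_graph u).
Let label (p : V) : bool := u p.2.

Definition slice (b : nat) (X : set nat) : set V := [set p | p.1 = b /\ X p.2].

Definition block_interval (b a n : nat) : set V := slice b [set i | a <= i < a + n].

Definition block_intervals : set (set V) :=
  [set A | exists b a n, A = block_interval b a n].

Lemma label_embeds_block_interval b a n b' a' n' :
  infix (factor u a n) (factor u a' n') ->
  label_embeds label (block_interval b a n) (block_interval b' a' n').
Proof.
move=> /infix_factorP[t]; rewrite size_factor => letn' ut.
have uE i : i < n -> u (a' + t + i) = u (a + i).
  by move=> lti; rewrite -!(nth_factor u _ lti) -ut.
exists (fun p : V => (b', a' + t + (p.2 - a))).
split=> [[? i] [/= _ i_int]|[? i] [? j] [/= -> i_int] [/= -> j_int]|[? i] [/= _ i_int]].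
- by split=> //=; lia.
- split=> [[] eq_off|]; first by congr pair; lia.
  by rewrite /block_adj /= !eqxx consecutiveD2l /consecutive; split; lia.
- by rewrite /label /= uE; [congr u|]; lia.
Qed.

Lemma almost_full_on_block_intervals :
  uniformly_recurrent u -> almost_full_on block_intervals (label_embeds label).
Proof.
move=> recu F.
have /choice[w wP] : forall n, exists w : nat * (nat * nat),
    sval (F n) = block_interval w.1 w.2.1 w.2.2.
  by move=> n; have [b [a [k Fn]]] := svalP (F n); exists (b, (a, k)).
have [i [j [ltij wij]]] := almost_full_factors recu (fun n => (w n).2).
by exists i, j; split=> //; rewrite !wP; apply: label_embeds_block_interval.
Qed.

Lemma joined_slice b (X Y : set nat) :
  (forall i j, X i -> Y j -> j.+1 < i) ->
  joined label never_adjacent (slice b X) (slice b Y).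
Proof.
move=> gap [? i] [? j] [/= -> Xi] [/= -> Yj]; have := gap i j Xi Yj.
split=> [[]|]; first by lia.
by rewrite /never_adjacent /= /block_adj /= eqxx /consecutive; split; lia.
Qed.

Lemma slice_setU b (X Y : set nat) : slice b (X `|` Y) = slice b X `|` slice b Y.
Proof.
by apply/seteqP; split=> p; [case=> eqb [Xp|Yp]; [left|right] |
  case=> -[eqb]; split=> //; [left|right]].
Qed.

(* [X] is scanned downwards; the interval is the part already met of the current run. *)
Lemma joins_slice_interval b (X : set nat) M n :
  joins label never_adjacent block_intervals
    (slice b ([set i | M <= i < M + n] `|` X `&` `I_M)).
Proof.
elim: M n => [|M IH] n.
  have -> : X `&` `I_0 = set0 by apply/seteqP; split=> i // [].
  rewrite slice_setU; apply: joins_setU; [by exists b, 0, n| |exact: joined_slice].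
  have -> : slice b set0 = set0 by apply/seteqP; split=> p // [].
  exact: joins_set0.
have [XM|nXM] := pselect (X M).
  rewrite (_ : _ `|` _ = [set i | M <= i < M + n.+1] `|` X `&` `I_M) //.
  apply/seteqP; split=> i /=; have [->|neM] := eqVneq i M.
  - by left; lia.
  - by case=> [?|[Xi ?]]; [left; lia | right; split=> //; lia].
  - by right.
  - by case=> [?|[Xi ?]]; [left; lia | right; split=> //; lia].
rewrite slice_setU; apply: joins_setU; first by exists b, M.+1, n.
  rewrite (_ : _ `&` _ = [set i | M <= i < M + 0] `|` X `&` `I_M) //.
  apply/seteqP; split=> i /= [].
  - move=> Xi lti; right; split=> //.
    by have [eqM|] := eqVneq i M; [rewrite eqM in Xi | lia].
  - by lia.
  - by move=> [Xi ?]; split=> //; lia.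
apply: joined_slice => i j /= i_int [Xj ltj].
by have [eqM|] := eqVneq j M; [rewrite eqM in Xj | lia].
Qed.

Definition block_sets : set (set V) := joins label never_adjacent block_intervals.

Lemma block_sets_slice b (X : set nat) M : X `<=` `I_M -> block_sets (slice b X).
Proof.
move=> /setIidl XM; have := joins_slice_interval b X M 0.
by rewrite XM (_ : [set i | _] = set0) ?set0U//; apply/seteqP; split=> i //=; lia.
Qed.

Lemma joins_finite_set (P : set V) :
  finite_set P -> joins label ones_adjacent block_sets P.
Proof.
move=> /finite_seqP[s PE].
pose M := (\max_(p <- s) maxn p.1 p.2).+1.
have ltM p : P p -> maxn p.1 p.2 < M.
  by rewrite PE ltnS => sp; apply: (@leq_bigmax_seq _ s xpredT (fun p => maxn p.1 p.2)).
suff joinsN N : joins label ones_adjacent block_sets (P `&` [set p | p.1 < N]).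
  by rewrite -[P](@setIidl _ _ [set p | p.1 < M]) // => p /ltM /=; lia.
elim: N => [|N IH].
  have -> : P `&` [set p | p.1 < 0] = set0 by apply/seteqP; split=> p // [].
  exact: joins_set0.
rewrite (_ : _ `&` _ =
    slice N [set i | P (N, i)] `|` P `&` [set p | p.1 < N]); last first.
  apply/seteqP; split=> [[b i] [Pp /=]|[b i]].
    by rewrite ltnS leq_eqVlt => /orP[/eqP eqb|]; [left; subst b | right].
  by case=> [[/= -> PNi]|[Pp /= ltb]]; split=> //=; lia.
apply: joins_setU => //.
  by apply: (@block_sets_slice _ _ M) => i /= /ltM /=; lia.
move=> [? i] [b' j] [/= -> _] [_ /= ltb']; split=> [[]|]; first by lia.
by rewrite /block_adj /= ifN //; lia.
Qed.

Lemma almost_full_on_finite_set :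
  uniformly_recurrent u ->
  almost_full_on [set P : set V | finite_set P] (label_embeds label).
Proof.
move=> recu F.
have fullJ : almost_full_on (joins label ones_adjacent block_sets) (label_embeds label).
  exact/almost_full_on_joins/almost_full_on_joins/almost_full_on_block_intervals.
exact: fullJ (fun n => exist _ (sval (F n)) (joins_finite_set (svalP (F n)))).
Qed.

End BlockSets.

Lemma word_graph_wqo u : uniformly_recurrent u -> wqo (age (word_graph u)).
Proof.
move=> recu [F [ageF antichainF]].
have /choice[P PE] : forall n, exists P : set (vertex (block_graph u)),
    exists2 e : vertex (F n) -> vertex (block_graph u),
      embedding_on setT e & P = range e.
  move=> n; have [_ /embedsP[e eemb]] := ageF n.
  exists (range (sval \o e)), (sval \o e) => //.
  exact: embedding_on_comp eemb (@embedding_on_sval (block_graph u) _).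
have finP n : finite_set (P n).
  by have [e _ ->] := PE n; apply: finite_image; have [] := ageF n.
have [i [j [ltij [f [/= fPij femb _]]]]] :=
  almost_full_on_finite_set recu (fun n => exist _ (P n) (finP n)).
have [ei eiemb PiE] := PE i; have [ej ejemb PjE] := PE j.
apply: (antichainF i j); first by move=> eqij; rewrite eqij ltnn in ltij.
by rewrite PiE PjE in fPij femb; apply: embeds_of_ranges eiemb ejemb femb fPij.
Qed.

(** * Incomparable ages *)

Definition share_factor (u v : nat -> bool) (n : nat) : Prop :=
  exists a b, factor u a n = factor v b n \/ factor u a n = rev (factor v b n).

(* Within one block, two vertices have at most one common neighbor. So the runs lie in
   different blocks, where the edges between them reveal the labels. *)
Lemma share_factor_of_runs (u v : nat -> bool) n s s' b b' (p q : nat -> nat) :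
  two_ones_in_windows u n -> sweeps_interval p n -> sweeps_interval q n ->
  (forall i j, i < n -> j < n ->
     block_adj v (b, p i) (b', q j) = u (s + i) && u (s' + j)) ->
  share_factor u v n.
Proof.
move=> twoones psweeps qsweeps adj_runs.
have [i1 [i2 [lti lti2 ui1 ui2]]] := twoones s.
have [j1 [j2 [ltj ltj2 uj1 uj2]]] := twoones s'.
have [lti1 ltj1] := (ltn_trans lti lti2, ltn_trans ltj ltj2).
have /negbTE neb : b != b'.
  apply/eqP => eqb; subst b'.
  have ones_consecutive i j : i < n -> j < n -> u (s + i) -> u (s' + j) ->
      consecutive (p i) (q j).
    move=> ltin ltjn ui uj; have := adj_runs i j ltin ltjn.
    by rewrite /block_adj eqxx ui uj.
  have [] := @consecutive_square_free (p i1) (p i2) (q j1) (q j2);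
    try exact: ones_consecutive.
    by move=> /(sweeps_interval_inj psweeps) eqi; rewrite eqi // ltnn in lti.
  by move=> /(sweeps_interval_inj qsweeps) eqj; rewrite eqj // ltnn in ltj.
have labels i j : i < n -> j < n -> v (p i) && v (q j) = u (s + i) && u (s' + j).
  by move=> ltin ltjn; rewrite -adj_runs // /block_adj /= neb.
have vj1 : v (q j1).
  by have := labels i1 j1 lti1 ltj1; rewrite ui1 uj1 => /andP[].
have uE : factor u s n = [seq v i | i <- mkseq p n].
  apply: (@eq_from_nth _ false); rewrite size_factor ?size_map ?size_iota // => i ltin.
  rewrite nth_factor // (nth_map 0) ?size_mkseq // nth_mkseq //.
  by have := labels i j1 ltin ltj1; rewrite uj1 vj1 !andbT.
have [c pE] := psweeps; exists s, c; rewrite uE.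
by case: pE => ->; [left | right; rewrite map_rev].
Qed.

Lemma share_factor_of_paths (u v : nat -> bool) n
    (p q : nat -> vertex (block_graph v)) :
  two_ones_in_windows u n ->
  induced_path (2 * n + 4) p -> induced_path (2 * n + 4) q ->
  (forall i j, i < 2 * n + 4 -> j < 2 * n + 4 ->
     block_adj v (p i) (q j) = u i && u j) ->
  share_factor u v n.
Proof.
move=> twoones ppath qpath pq.
have [s [b [p' [les pE p'sweeps]]]] := induced_path_run ppath.
have [s' [b' [q' [les' qE q'sweeps]]]] := induced_path_run qpath.
apply: (@share_factor_of_runs u v n s s' b b' p' q' twoones p'sweeps q'sweeps).
by move=> i j lti ltj; rewrite -pE // -qE // pq //; lia.
Qed.

Lemma word_graph_age_share_factor (u v : nat -> bool) n :
  two_ones_in_windows u n -> age (word_graph u) `<=` age (word_graph v) ->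
  share_factor u v n.
Proof.
move=> twoones sub_age; set N := 2 * n + 4.
pose A : set (vertex (word_graph u)) :=
  block_vertex u N @` `I_N `|` block_vertex u N.+1 @` `I_N.
have finA : finite_set A.
  by rewrite finite_setU; split; exact: (finite_image _ (finite_II N)).
have A0 : A !=set0.
  by exists (block_vertex u N 0); left; exists 0 => //; rewrite /= /N addn4.
have [f femb] := age_subset_embedding_on sub_age finA A0.
have gemb : @embedding_on _ (block_graph v) A (sval \o f).
  exact: embedding_on_comp femb (@embedding_on_sval (block_graph v) _).
have gpath b : block_vertex u b @` `I_N `<=` A -> N <= b ->
    induced_path N (sval \o f \o block_vertex u b).
  move=> bA leNb; apply: embedding_on_comp gemb => [i ltiN|].
    by apply: bA; exists i.
  exact/block_vertex_induced_path/(leq_trans leNb)/leq_addr.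
apply: (share_factor_of_paths twoones (gpath N _ _) (gpath N.+1 _ _)) => //.
- exact: subsetUl.
- exact: subsetUr.
move=> i j lti ltj.
have [||_ gadj] := gemb (block_vertex u N i) (block_vertex u N.+1 j).
- by left; exists i.
- by right; exists j.
rewrite adj_block_vertex in gadj; [|lia|lia].
have -> : u i && u j = block_adj u (N, i) (N.+1, j).
  by rewrite /block_adj /= ifN //; lia.
by apply/idP/idP => /gadj.
Qed.

(** * The family of words *)

(* All digits in even positions vanish, so two such sequences both have a 0
   right after their first difference. *)
Definition digits (b : set nat) (n : nat) : bool :=
  match n with 0 => false | 1 => true | m.+2 => odd m && `[< b m./2 >] end.

Lemma digits_first_difference (b b' : set nat) : b <> b' ->
  exists k, [/\ forall i, i < k -> digits b i = digits b' i,
    digits b k <> digits b' k, ~~ digits b k.+1 & ~~ digits b' k.+1].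
Proof.
move=> neb; have exk : exists k, digits b k != digits b' k.
  apply: contrapT => same; apply: neb; apply/seteqP.
  have sameb i : `[< b i >] = `[< b' i >].
    have : digits b i.*2.+3 = digits b' i.*2.+3.
      by apply/eqP; apply: contrapT => /negP ne; apply: same; exists i.*2.+3.
    by rewrite /= odd_double uphalf_double.
  by split=> i /asboolP; [rewrite sameb | rewrite -sameb] => /asboolP.
case: (ex_minnP exk) => k /eqP nek kmin; exists k.
have nextk c : ~~ digits c k.+1 by case: (k) nek => [|[|m]] //=; case: (odd m).
by split=> // i ltik; apply/eqP; apply: contraTT ltik => /kmin; rewrite -leqNgt.
Qed.

Definition digits_graph (b : set nat) : graph := word_graph (toeplitz (digits b)).

Lemma digits_graph_age (b b' : set nat) :
  b <> b' -> ~ (age (digits_graph b) `<=` age (digits_graph b')).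
Proof.
move=> /digits_first_difference[k [agree differ nb nb']] sub_age.
have le8 : 8 <= 2 ^ (k + 3) by rewrite expnD leq_pmull // expn_gt0.
have [s [c common]] :=
  word_graph_age_share_factor (toeplitz_two_ones (isT : digits b 1) le8) sub_age.
apply: (count_factor_toeplitz_neq agree differ nb nb' (p := s) (q := c)).
by case: common => ->; rewrite ?count_rev.
Qed.

Lemma digits_graph_prime b : prime_graph (digits_graph b).
Proof.
by apply: (@word_graph_prime _ 1 5) => // n; apply: toeplitz_isolated_ones.
Qed.

Theorem theorem10 :
  exists S : set graph,
    [/\ S #= [set: set nat],
        forall G, S G -> [/\ path_minimal G, prime_graph G & wqo (age G)] &
        forall G H, S G -> S H -> G <> H ->
          ~ (age G `<=` age H) /\ ~ (age H `<=` age G)].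
Proof.
exists (range digits_graph); split.
- apply: inj_card_eq => b b' _ _ eqG; apply: contrapT => /digits_graph_age; apply.
  by rewrite eqG.
- move=> _ [b _ <-]; have recb := toeplitz_uniformly_recurrent (digits b).
  split; first exact: word_graph_path_minimal.
    exact: digits_graph_prime.
  exact: word_graph_wqo.
- move=> _ _ [b _ <-] [b' _ <-] neG.
  have neb : b <> b' by move=> eqb; apply: neG; rewrite eqb.
  by split; apply: digits_graph_age => // eqb; apply: neb.
Qed.
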